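(* For every $f\in\mathcal F^{\,r}_{op}$, every faithful $\rho\in\mathcal D^1_n$ and every self-adjoint $A\in M_n(\mathbb C)$, $$I^f_\rho(A)\le I^{SLD}_\rho(A)\le \frac{1}{2f(0)}\,I^f_\rho(A).$$ In particular, for the Wigner–Yanase information $I^{WY}_\rho(A)=-\frac12\mathrm{Tr}([\rho^{1/2},A]^2)$ (which equals $I^{f_{WY}}_\rho(A)$ with $f_{WY}(x)=\big(\frac{1+\sqrt x}{2}\big)^2$, $f_{WY}(0)=\frac14$), one has $I^{WY}_\rho(A)\le I^{SLD}_\rho(A)\le 2 I^{WY}_\rho(A)$.
   Context: $\mathcal F_{op}$ is the class of functions $f:(0,\infty)\to(0,\infty)$ that are operator monotone, satisfy $f(1)=1$ and $tf(t^{-1})=f(t)$ for all $t>0$. $f(0):=\lim_{x\to0^+}f(x)$, and $\mathcal F^{\,r}_{op}=\{f\in\mathcal F_{op}: f(0)\neq0\}$. $\mathcal D_n^1$ is the set of strictly positive $n\times n$ density matrices. For $x,y>0$, $m_f(x,y)=xf(y/x)$; $L_\rho(X)=\rho X$, $R_\rho(X)=X\rho$, and $m_f(L_\rho,R_\rho)$ multiplies the entry $X_{ij}$ of $X$ (in an orthonormal eigenbasis of $\rho$ with eigenvalues $\lambda_i$) by $m_f(\lambda_i,\lambda_j)$. $\|X\|^2_{\rho,f}=\mathrm{Tr}\big(X^* m_f(L_\rho,R_\rho)^{-1}(X)\big)$. The $f$-information is $I^f_\rho(A)=\frac{f(0)}{2}\|i[\rho,A]\|^2_{\rho,f}$. The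 SLD-information is $I^{SLD}_\rho(A)=\frac14\mathrm{Tr}(\rho L^2)$ with $L=2(L_\rho+R_\rho)^{-1}(i[\rho,A])$; equivalently $I^{SLD}_\rho=I^{f_{SLD}}_\rho$ with $f_{SLD}(x)=\frac{1+x}{2}$. *)

(* Defs.v *)
From HB Require Import structures.
From mathcomp Require Import all_boot all_order all_algebra.
From mathcomp Require Import complex.
From mathcomp Require Import classical_sets reals topology normedtype.

Set Implicit Arguments.
Unset Strict Implicit.
Unset Printing Implicit Defensive.

Import Order.TTheory GRing.Theory Num.Theory.
Local Open Scope ring_scope.

Definition adj (R : rcfType) (m n : nat) (A : 'M[R[i]]_(m, n)) : 'M[R[i]]_(n, m) :=
  (map_mx Num.conj A)^T.

Definition unitary (R : rcfType) (n : nat) (U : 'M[R[i]]_n) : Prop :=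
  U *m adj U = 1%:M /\ adj U *m U = 1%:M.

Definition hermitian_mx (R : rcfType) (n : nat) (A : 'M[R[i]]_n) : Prop :=
  adj A = A.

Definition diagR (R : rcfType) (n : nat) (d : 'I_n -> R) : 'M[R[i]]_n :=
  diag_mx (\row_i ((d i)%:C)%C).

(** U diag(d) U^* ; for unitary U and real d this is the Hermitian matrix with
    eigenvalues d i and orthonormal eigenbasis the columns of U *)
Definition spec_mx (R : rcfType) (n : nat) (U : 'M[R[i]]_n) (d : 'I_n -> R)
  : 'M[R[i]]_n := U *m diagR d *m adj U.

(** positive semidefinite / positive definite (the complex order of R[i]
    forces the quadratic form to be real) *)
Definition psd (R : rcfType) (n : nat) (A : 'M[R[i]]_n) : Prop :=
  forall x : 'cV[R[i]]_n, 0 <= (adj x *m A *m x) 0 0.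

Definition posdef (R : rcfType) (n : nat) (A : 'M[R[i]]_n) : Prop :=
  forall x : 'cV[R[i]]_n, x != 0 -> 0 < (adj x *m A *m x) 0 0.

Definition loewner_le (R : rcfType) (n : nat) (A B : 'M[R[i]]_n) : Prop :=
  psd (B - A).

(** operator monotone on (0,oo): for every size n and all positive definite
    A = U diag(d) U^*, B = V diag(e) V^* (spectral decompositions),
    A <= B implies f(A) <= f(B), with f(A) = U diag(f o d) U^*. *)
Definition operator_monotone (R : rcfType) (f : R -> R) : Prop :=
  forall (n : nat) (U V : 'M[R[i]]_n) (d e : 'I_n -> R),
    unitary U -> unitary V ->
    (forall k, 0 < d k) -> (forall k, 0 < e k) ->
    loewner_le (spec_mx U d) (spec_mx V e) ->
    loewner_le (spec_mx U (fun k => f (d k))) (spec_mx V (fun k => f (e k))).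

Definition F_op (R : rcfType) (f : R -> R) : Prop :=
  [/\ (forall x, 0 < x -> 0 < f x),
      operator_monotone f,
      f 1 = 1 &
      (forall t, 0 < t -> t * f t^-1 = f t)].

Definition faithful_density (R : rcfType) (n : nat) (rho : 'M[R[i]]_n) : Prop :=
  [/\ hermitian_mx rho, posdef rho & \tr rho = 1].

Definition m_f (R : rcfType) (f : R -> R) (x y : R) : R := x * f (y / x).

Definition commutator (R : rcfType) (n : nat) (A B : 'M[R[i]]_n) : 'M[R[i]]_n :=
  A *m B - B *m A.

(** m_f(L_rho, R_rho)^{-1}(X), computed in the eigenbasis (columns of U) of
    rho = U diag(lam) U^* : entry X_ij (in that basis) is divided by
    m_f(lam i, lam j). *)
Definition mf_inv (R : rcfType) (n : nat) (f : R -> R) (U : 'M[R[i]]_n)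
  (lam : 'I_n -> R) (X : 'M[R[i]]_n) : 'M[R[i]]_n :=
  U *m (\matrix_(i, j) ((adj U *m X *m U) i j / ((m_f f (lam i) (lam j))%:C)%C))
    *m adj U.

Definition fnorm2 (R : rcfType) (n : nat) (f : R -> R) (U : 'M[R[i]]_n)
  (lam : 'I_n -> R) (X : 'M[R[i]]_n) : R[i] :=
  \tr (adj X *m mf_inv f U lam X).

(** f-information I^f_rho(A) = f(0)/2 ||i[rho,A]||^2_{rho,f}, where f0 = f(0) *)
Definition f_info (R : rcfType) (n : nat) (f : R -> R) (f0 : R)
  (U : 'M[R[i]]_n) (lam : 'I_n -> R) (A : 'M[R[i]]_n) : R[i] :=
  ((f0 / 2)%:C)%C *
    fnorm2 f U lam ('i%C *: commutator (spec_mx U lam) A).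

(** SLD: L = 2 (L_rho + R_rho)^{-1}(i[rho,A]), I^SLD = 1/4 Tr(rho L^2) *)
Definition sld_L (R : rcfType) (n : nat) (U : 'M[R[i]]_n) (lam : 'I_n -> R)
  (A : 'M[R[i]]_n) : 'M[R[i]]_n :=
  let Y := 'i%C *: commutator (spec_mx U lam) A in
  U *m (\matrix_(i, j) (2 * (adj U *m Y *m U) i j / ((lam i + lam j)%:C)%C))
    *m adj U.

Definition sld_info (R : rcfType) (n : nat) (U : 'M[R[i]]_n) (lam : 'I_n -> R)
  (A : 'M[R[i]]_n) : R[i] :=
  4^-1 * \tr (spec_mx U lam *m (sld_L U lam A *m sld_L U lam A)).

Definition wy_info (R : rcfType) (n : nat) (U : 'M[R[i]]_n) (lam : 'I_n -> R)
  (A : 'M[R[i]]_n) : R[i] :=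
  let C := commutator (spec_mx U (fun k => Num.sqrt (lam k))) A in
  - 2^-1 * \tr (C *m C).

(* Main.v *)
Require Import Defs.
From HB Require Import structures.
From mathcomp Require Import all_boot all_order all_algebra.
From mathcomp Require Import complex.
From mathcomp Require Import classical_sets reals topology normedtype.
From mathcomp Require Import ring lra.
Import Order.TTheory GRing.Theory Num.Theory numFieldNormedType.Exports.
Local Open Scope ring_scope.

(** In an eigenbasis of [rho] all three informations are sums of [|a_ij|^2],
    where [a = U^* A U], with weights depending on the eigenvalues [x = lam i]
    and [y = lam j]: [f0 (x-y)^2 / (2 m_f(x,y))] for the [f]-information,
    [(x-y)^2 / (2 (x+y))] for SLD (after symmetrizing in [i] and [j]) and
    [(sqrt x - sqrt y)^2 / 2] for Wigner-Yanase. The claim thus reduces to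
    [f0 (1 + t) <= f t <= (1 + t) / 2]. Operator monotonicity for 2x2 matrices
    implies concavity: a rotated [diag(a, b)] has upper left entry a convex
    combination of [a] and [b], and is dominated by [diag(p, K)] for any [p]
    above that entry and [K] large. Concavity along the chord from [t^-1] to
    [t], combined with [t f(1/t) = f t], gives the upper bound at [1]; along
    the chord from [x] to [x^-1], with [x -> 0+], it gives the lower bound. *)

Set Implicit Arguments.
Unset Strict Implicit.

(** * Adjoints and quadratic forms of spectral matrices *)

Lemma adjE (R : rcfType) (m n : nat) (A : 'M[R[i]]_(m, n)) i j :
  adj A i j = (A j i)^*.
Proof. by rewrite !mxE. Qed.

Lemma adjM (R : rcfType) (m n p : nat) (A : 'M[R[i]]_(m, n))
    (B : 'M[R[i]]_(n, p)) :
  adj (A *m B) = adj B *m adj A.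
Proof. by rewrite /adj map_mxM trmx_mul. Qed.

Lemma adjK (R : rcfType) (m n : nat) (A : 'M[R[i]]_(m, n)) : adj (adj A) = A.
Proof. by apply/matrixP => i j; rewrite !adjE conjCK. Qed.

Lemma adj1 (R : rcfType) (n : nat) : adj (1%:M : 'M[R[i]]_n) = 1%:M.
Proof. by rewrite /adj map_mx1 trmx1. Qed.

Lemma conjC_real (R : rcfType) (x : R) : ((x%:C)%C : R[i])^* = (x%:C)%C.
Proof. exact: conjc_real. Qed.

Lemma quad_spec (R : rcfType) (n : nat) (U : 'M[R[i]]_n) (d : 'I_n -> R)
    (x : 'cV[R[i]]_n) :
  (adj x *m spec_mx U d *m x) 0 0
  = \sum_k ((d k)%:C)%C * `|(adj U *m x) k 0| ^+ 2.
Proof.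
have -> : adj x *m spec_mx U d *m x
          = adj (adj U *m x) *m (diagR d *m (adj U *m x)).
  by rewrite adjM adjK /spec_mx !mulmxA.
move: (adj U *m x) => y; rewrite mxE; apply: eq_bigr => k _.
by rewrite adjE /diagR mul_diag_mx !mxE normCKC mulrCA.
Qed.

(** * Plane rotations and Loewner comparison of 2x2 matrices *)

Definition rotation (R : rcfType) (c s : R) : 'M[R[i]]_2 :=
  \matrix_(i < 2, j < 2)
    ((if i == j then c else if i == 0 then - s else s)%:C)%C.

Definition pair_fun (R : rcfType) (a b : R) : 'I_2 -> R :=
  fun k => if k == 0 then a else b.

Lemma unitary_rotation (R : rcfType) (c s : R) :
  c ^+ 2 + s ^+ 2 = 1 -> unitary (rotation c s).
Proof.
move=> cs1; split; apply/matrixP => i j;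
  rewrite !mxE !big_ord_recl big_ord0 addr0 !adjE !mxE !conjC_real
          -!rmorphM -rmorphD;
  have -> : ((i == j)%:R : R[i]) = (((i == j)%:R : R)%:C)%C
    by rewrite rmorph_nat.
all: congr (_%:C)%C.
all: case: i => [[|[|//]] ?]; case: j => [[|[|//]] ?] /=.
all: rewrite ?mulr1n ?mulr0n -?cs1; ring.
Qed.

Lemma adj_rotation_mul (R : rcfType) (c s : R) (x : 'cV[R[i]]_2) :
  ((adj (rotation c s) *m x) 0 0 = (c%:C)%C * x 0 0 + (s%:C)%C * x 1 0) *
  ((adj (rotation c s) *m x) 1 0 = ((- s)%:C)%C * x 0 0 + (c%:C)%C * x 1 0).
Proof.
split; rewrite !mxE !big_ord_recl big_ord0 addr0 !adjE !mxE !conjC_real /=;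
by congr (_ * x _ _ + _ * x _ _); apply/val_inj.
Qed.

Lemma unitary1 (R : rcfType) n : unitary (1%:M : 'M[R[i]]_n).
Proof. by split; rewrite adj1 mulmx1. Qed.

Lemma sqr_norm_comb (R : rcfType) (c s : R) (z w : R[i]) :
  `|(c%:C)%C * z + (s%:C)%C * w| ^+ 2 =
  (((c * complex.Re z + s * complex.Re w) ^+ 2
   + (c * complex.Im z + s * complex.Im w) ^+ 2)%:C)%C.
Proof.
rewrite -add_Re2_Im2; case: z => a b; case: w => a' b' /=.
by congr (_%:C)%C; ring.
Qed.

(** The difference of the two matrices has upper left entry [e > 0] and off-diagonal entry [- m].
    Choosing [K] so that its lower right entry is [m ^+ 2 / e] makes the determinant vanish, and the
    quadratic form becomes a single square. *)
Lemma loewner_rotation_diag (R : rcfType) (a b c s p : R) :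
    c ^+ 2 + s ^+ 2 = 1 -> 0 < a -> 0 < b ->
    c ^+ 2 * a + s ^+ 2 * b < p ->
  exists2 K, 0 < K &
    loewner_le (spec_mx (rotation c s) (pair_fun a b))
               (spec_mx 1%:M (pair_fun p K)).
Proof.
move=> cs1 a0 b0 ltp; set e := p - (c ^+ 2 * a + s ^+ 2 * b).
have e0 : 0 < e by rewrite subr_gt0.
set m := c * s * (a - b).
pose K := s ^+ 2 * a + c ^+ 2 * b + m ^+ 2 / e.
have K0 : 0 < K.
  have m2 : 0 <= m ^+ 2 / e by rewrite divr_ge0 ?sqr_ge0 ?ltW.
  have : 0 <= c ^+ 2 * a by rewrite mulr_ge0 ?sqr_ge0 ?ltW.
  have : 0 <= s ^+ 2 * b by rewrite mulr_ge0 ?sqr_ge0 ?ltW.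
  (* [s ^+ 2 * a + c ^+ 2 * b] is a convex combination, hence at least the smaller of [a] and
     [b]. *)
  case: (leP a b) => ab.
    have : 0 <= c ^+ 2 * (b - a) by rewrite mulr_ge0 ?sqr_ge0 ?subr_ge0.
    have : s ^+ 2 * a = a - c ^+ 2 * a.
      by rewrite -[s ^+ 2](addKr (c ^+ 2)) cs1; ring.
    rewrite /K; lra.
  have : 0 <= s ^+ 2 * (a - b) by rewrite mulr_ge0 ?sqr_ge0 ?subr_ge0 ?ltW.
  have : c ^+ 2 * b = b - s ^+ 2 * b.
    by rewrite -[c ^+ 2](addrK (s ^+ 2)) cs1; ring.
  rewrite /K; lra.
have quad u v : 0 <= p * u ^+ 2 + K * v ^+ 2
    - a * (c * u + s * v) ^+ 2 - b * (- s * u + c * v) ^+ 2.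
  rewrite [leRHS](_ : _ = e * (u - m * v / e) ^+ 2).
    by rewrite mulr_ge0 ?sqr_ge0 ?ltW.
  have -> : p = e + (c ^+ 2 * a + s ^+ 2 * b) by rewrite /e; ring.
  by rewrite /K /m; field; rewrite gt_eqF.
exists K => // x.
rewrite mulmxBr mulmxBl [X in 0 <= X]mxE [X in _ + X]mxE !quad_spec.
rewrite adj1 mul1mx !big_ord_recl !big_ord0 !addr0.
have -> : lift ord0 ord0 = 1 :> 'I_2 by apply/val_inj.
rewrite !adj_rotation_mul !sqr_norm_comb /pair_fun /= -!add_Re2_Im2.
rewrite -!rmorphM -!rmorphD -rmorphB (lecR 0).
(* Both matrices are real symmetric, so the form splits into its values at the real and imaginary
   parts of [x]. *)
have := quad (complex.Re (x 0 0)) (complex.Re (x 1 0)).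
have := quad (complex.Im (x 0 0)) (complex.Im (x 1 0)).
lra.
Qed.

(** * Concavity from operator monotonicity *)

Lemma operator_monotone_slack (R : rcfType) (f : R -> R) (a b l p : R) :
    operator_monotone f -> 0 < a -> 0 < b -> 0 <= l <= 1 ->
    l * a + (1 - l) * b < p ->
  l * f a + (1 - l) * f b <= f p.
Proof.
move=> fmon a0 b0 /andP[l0 l1] ltp.
have cE : Num.sqrt l ^+ 2 = l by rewrite sqr_sqrtr.
have sE : Num.sqrt (1 - l) ^+ 2 = 1 - l by rewrite sqr_sqrtr ?subr_ge0.
set c := Num.sqrt l in cE; set s := Num.sqrt (1 - l) in sE.
have cs1 : c ^+ 2 + s ^+ 2 = 1 by rewrite cE sE addrC subrK.
have ltp' : c ^+ 2 * a + s ^+ 2 * b < p by rewrite cE sE.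
have [K K0 leK] := loewner_rotation_diag cs1 a0 b0 ltp'.
have p0 : 0 < p by apply: le_lt_trans ltp; nra.
have pos (u v : R) : 0 < u -> 0 < v -> forall k, 0 < pair_fun u v k.
  by move=> u0 v0 k; rewrite /pair_fun; case: ifP.
(* The first basis vector reads off the upper left entries, so the uncontrolled value [f K] drops
   out. *)
have := fmon _ _ _ _ _ (unitary_rotation cs1) (unitary1 _ _) (pos _ _ a0 b0)
  (pos _ _ p0 K0) leK (delta_mx 0 0).
rewrite mulmxBr mulmxBl [X in 0 <= X]mxE [X in _ + X]mxE !quad_spec.
rewrite adj1 mul1mx !big_ord_recl !big_ord0 !addr0.
have -> : lift ord0 ord0 = 1 :> 'I_2 by apply/val_inj.
rewrite !adj_rotation_mul !sqr_norm_comb /pair_fun /= -!add_Re2_Im2 !mxE /=.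
rewrite -!rmorphM -!rmorphD -rmorphB (lecR 0).
by move=> h; rewrite -sE -cE; move: h => /=; lra.
Qed.

(* The slack is absorbed by perturbing the weight instead of the argument of
   [f], so no continuity of [f] is needed. *)
Lemma operator_monotone_concave (R : rcfType) (f : R -> R) (a b l : R) :
    operator_monotone f -> 0 < a -> a < b -> 0 <= l -> l < 1 ->
  l * f a + (1 - l) * f b <= f (l * a + (1 - l) * b).
Proof.
move=> fmon a0 ab l0 l1; set p := l * a + _.
have b0 : 0 < b by apply: lt_trans ab.
have H t : 0 < t <= 1 ->
    (l + t * (1 - l)) * f a + (1 - (l + t * (1 - l))) * f b <= f p.
  move=> /andP[t0 t1]; have tl : 0 < t * (1 - l) by rewrite mulr_gt0 ?subr_gt0.
  apply: operator_monotone_slack => //.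
    apply/andP; split; first by rewrite addr_ge0 // ltW.
    have : t * (1 - l) <= 1 * (1 - l) by rewrite ler_wpM2r // subr_ge0 ltW.
    lra.
  (* Moving weight from [b] to the smaller point [a] brings the mean strictly below [p]. *)
  have : 0 < t * (1 - l) * (b - a) by rewrite mulr_gt0 ?subr_gt0.
  by rewrite /p; lra.
rewrite leNgt; apply/negP => lt_f.
set D := l * f a + (1 - l) * f b - f p.
have D0 : 0 < D by rewrite subr_gt0.
set N := `|f a - f b| + 1.
have N0 : 0 < N by rewrite ltr_wpDl.
have Nle : - N < f a - f b.
  by rewrite /N; have := ler_norm (f b - f a); rewrite distrC; lra.
(* The perturbation lowers the combination of values by less than [t * N <= D], too little to close
   the assumed gap [D]. *)
pose t := Num.min 1 (D / N).
have t0 : 0 < t by rewrite lt_min ltr01 divr_gt0.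
have t1 : t <= 1 by rewrite ge_min lexx.
have tD : t * N <= D by rewrite -ler_pdivlMr // ge_min lexx orbT.
have := H t; rewrite t0 t1 => /(_ isT).
have : t * (1 - l) * - N < t * (1 - l) * (f a - f b).
  by rewrite ltr_pM2l // mulr_gt0 ?subr_gt0.
have : l * (t * N) >= 0 by rewrite mulr_ge0 // mulr_ge0 // ltW.
move: tD; rewrite /D; lra.
Qed.

(** * Linear upper and lower bounds on [f] *)

Lemma F_op_le_mean (R : rcfType) (f : R -> R) (t : R) :
  F_op f -> 0 < t -> f t <= (1 + t) / 2.
Proof.
move=> [_ fmon f1 fsym].
(* [1] is the mean of [t^-1] and [t] with weights [t / (1 + t)] and
   [1 / (1 + t)], and both values contribute [f t / (1 + t)]. *)
have lt1 (u : R) : 1 < u -> f u <= (1 + u) / 2.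
  move=> u1; have u0 : 0 < u by apply: lt_trans u1.
  have v0 : 0 < 1 + u by rewrite addr_gt0.
  have l0 : 0 <= u / (1 + u) by rewrite divr_ge0 ?ltW.
  have l1 : u / (1 + u) < 1 by rewrite ltr_pdivrMr // mul1r ltrDr.
  have ltu : u^-1 < u by rewrite (lt_trans _ u1) // invf_lt1.
  have u0' : 0 < u^-1 by rewrite invr_gt0.
  have := operator_monotone_concave fmon u0' ltu l0 l1.
  rewrite [X in _ <= f X](_ : _ = 1); last by field; rewrite !gt_eqF.
  have -> : f u^-1 = f u / u by rewrite -(fsym u) // mulrAC divff ?mul1r ?gt_eqF.
  rewrite f1 [X in X <= _](_ : _ = f u * 2 / (1 + u)); last first.
    by field; rewrite !gt_eqF.
  by rewrite ler_pdivrMr // mul1r ler_pdivlMr.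
move=> t0; case: (ltgtP t 1) => [t1|/lt1 //|->]; last by rewrite f1; lra.
(* The mean [(1 + t) / 2] obeys the same symmetry as [f], so the bound at [t^-1 > 1] carries
   over. *)
rewrite -fsym // -ler_pdivlMl //; apply: le_trans (lt1 t^-1 _) _.
  by rewrite invf_gt1.
by rewrite le_eqVlt; apply/orP; left; apply/eqP; field; rewrite gt_eqF.
Qed.

(** Since [f x^-1 = f x / x], the chord of [f] from [x] to [x^-1] is the linear function
    [f x * (1 + t) / (1 + x)] of [t]; concavity puts it below [f]. *)
Lemma F_op_chord (R : rcfType) (f : R -> R) (x t : R) :
  F_op f -> 0 < x -> x < 1 -> x < t -> t < x^-1 ->
  f x <= f t / (1 + t) * (1 + x).
Proof.
move=> [_ fmon _ fsym] x0 x1 xt tx.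
have t0 : 0 < t by apply: lt_trans xt.
have lx : 0 < 1 - x ^+ 2 by rewrite subr_gt0 expr_lt1 // ltW.
(* The weight with [t = l * x + (1 - l) * x^-1]. *)
pose l := (1 - t * x) / (1 - x ^+ 2).
have tx1 : t * x < 1 by rewrite -ltr_pdivlMr // mul1r.
have l0 : 0 <= l by rewrite divr_ge0 // ltW // subr_gt0.
have l1 : l < 1.
  by rewrite ltr_pdivrMr // mul1r ltrD2l ltrN2 expr2 ltr_pM2r.
have := operator_monotone_concave fmon x0 (lt_trans xt tx) l0 l1.
have nz : 1 - x ^+ 2 != 0 by rewrite gt_eqF.
have nx : x != 0 by rewrite gt_eqF.
have n1x : 1 + x != 0 by rewrite gt_eqF // addr_gt0.
have n1x' : 1 - x != 0 by rewrite gt_eqF // subr_gt0.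
have nz' : (1 - x) * (1 + x) != 0 by rewrite mulf_neq0.
have n1t : 0 < 1 + t by rewrite addr_gt0.
have lE : l = (1 - t * x) / ((1 - x) * (1 + x)).
  by rewrite /l; congr (_ / _); ring.
rewrite lE [X in _ <= f X](_ : _ = t); last first.
  by field; rewrite nx n1x n1x'.
have -> : f x^-1 = f x / x by rewrite -(fsym x) // mulrAC divff ?mul1r.
rewrite [X in X <= _](_ : _ = f x * ((1 + t) / (1 + x))); last first.
  by field; rewrite nx n1x n1x'.
have v0 : 0 < (1 + t) / (1 + x) by rewrite divr_gt0 // addr_gt0.
rewrite -ler_pdivlMr // => h; apply: le_trans h _.
by rewrite invf_div mulrAC mulrA.
Qed.

Lemma F_op_ge_f0 (R : realType) (f : R -> R) (f0 t : R) :
  F_op f -> (f x @[x --> 0^'+] --> f0)%classic -> 0 < t ->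
  f0 * (1 + t) <= f t.
Proof.
move=> Ff cf t0.
have v0 : 0 < 1 + t by rewrite addr_gt0.
rewrite -ler_pdivlMr //.
have ft0 : 0 < f t / (1 + t) by case: Ff => fp _ _ _; rewrite divr_gt0 ?fp.
apply/ler_addgt0Pr => e e0; apply: (cvgr_to_le cf).
near=> x.
have x0 : 0 < x by near: x; exact: nbhs_right_gt.
have x1 : x < 1 by near: x; exact: nbhs_right_lt.
have xt : x < t by near: x; exact: nbhs_right_lt.
have xt' : x < t^-1 by near: x; apply: nbhs_right_lt; rewrite invr_gt0.
(* Bounds the excess [f t / (1 + t) * x] of the chord estimate over its limit by [e]. *)
have xe : x < e / (f t / (1 + t)).
  by near: x; apply: nbhs_right_lt; rewrite divr_gt0.
apply: le_trans (@F_op_chord _ f x t Ff x0 x1 xt _) _.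
  by rewrite -[t]invrK ltf_pV2 ?posrE ?invr_gt0.
by rewrite mulrDr mulr1 lerD2l mulrC -ler_pdivlMr // ltW.
Unshelve. all: by end_near.
Qed.

(** * Passage to an eigenbasis *)

Lemma spec_mx_eigenvalue_gt0 (R : rcfType) (n : nat) (U : 'M[R[i]]_n)
    (lam : 'I_n -> R) :
  unitary U -> posdef (spec_mx U lam) -> forall k, 0 < lam k.
Proof.
(* The [k]-th column of [U] isolates [lam k] in the quadratic form. *)
move=> [_ U1] rho0 k; pose x : 'cV[R[i]]_n := U *m delta_mx k 0.
have xE : adj U *m x = delta_mx k 0 by rewrite /x mulmxA U1 mul1mx.
have x0 : x != 0.
  apply/eqP => x0; have /matrixP/(_ k 0) := xE.
  by rewrite x0 mulmx0 !mxE !eqxx => /eqP; rewrite eq_sym oner_eq0.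
have := rho0 x x0; rewrite quad_spec xE (bigD1 k) //= big1 => [|j jk].
  by rewrite !mxE !eqxx normr1 expr1n mulr1 addr0 (ltcR 0).
by rewrite !mxE (negPf jk) normr0 expr0n mulr0.
Qed.

Lemma mxtrace_conj (R : rcfType) (n : nat) (U X : 'M[R[i]]_n) :
  unitary U -> \tr (U *m X *m adj U) = \tr X.
Proof. by case=> _ U1; rewrite mxtrace_mulC mulmxA U1 mul1mx. Qed.

Lemma unconj_mx (R : rcfType) (n : nat) (U X : 'M[R[i]]_n) :
  unitary U -> X = U *m (adj U *m X *m U) *m adj U.
Proof.
by case=> U1 _; rewrite -!mulmxA U1 mulmx1 mulmxA U1 mul1mx.
Qed.

Lemma conj_mxM (R : rcfType) (n : nat) (U X Y : 'M[R[i]]_n) :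
  unitary U ->
  (U *m X *m adj U) *m (U *m Y *m adj U) = U *m (X *m Y) *m adj U.
Proof.
by case=> _ U1; rewrite -!mulmxA (mulmxA (adj U)) U1 mul1mx.
Qed.

(** Kept general in [d]: it serves both [rho], with [d = lam], and its square root, which enters the
    Wigner-Yanase information. *)
Lemma commutator_eigenbasis (R : rcfType) (n : nat) (U A : 'M[R[i]]_n)
    (d : 'I_n -> R) :
  unitary U ->
  commutator (spec_mx U d) A
  = U *m (\matrix_(i, j) (((d i - d j)%:C)%C * (adj U *m A *m U) i j))
      *m adj U.
Proof.
move=> Uu; rewrite {1}[A](unconj_mx _ Uu).
move: (adj U *m A *m U) => B.
rewrite /commutator /spec_mx !conj_mxM // -mulmxBl -mulmxBr.
congr (_ *m _ *m _); apply/matrixP => i j.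
by rewrite /diagR mul_diag_mx mul_mx_diag !mxE rmorphB mulrBl [B i j * _]mulrC.
Qed.

Lemma hermitian_eigenbasis (R : rcfType) (n : nat) (U A : 'M[R[i]]_n) i j :
  hermitian_mx A ->
  (adj U *m A *m U) j i = ((adj U *m A *m U) i j)^*.
Proof.
by move=> hA; rewrite -adjE !adjM adjK hA mulmxA.
Qed.

(** * The three informations as weighted sums of [|B i j|^2] *)

Section Eigenbasis.
Variables (R : rcfType) (n : nat) (U A : 'M[R[i]]_n) (lam : 'I_n -> R).
Hypothesis (Uu : unitary U) (hA : hermitian_mx A).
Hypothesis lam0 : forall k, 0 < lam k.

Let B := adj U *m A *m U.
Let w i j : R[i] := `|B i j| ^+ 2.

Lemma eigen_weight_sym i j : w i j = w j i.
Proof. by rewrite /w /B (hermitian_eigenbasis U j i hA) norm_conjC. Qed.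

Lemma eigen_weightE i j : B i j * B j i = w i j.
Proof. by rewrite /w normCK -hermitian_eigenbasis. Qed.

Lemma eigen_weight_ge0 i j : 0 <= w i j.
Proof. exact: exprn_ge0. Qed.

Lemma adj_commutator_eigenbasis i j :
  (adj U *m ('i%C *: commutator (spec_mx U lam) A) *m U) i j
  = 'i%C * (((lam i - lam j)%:C)%C * B i j).
Proof.
case: Uu => _ U1.
rewrite commutator_eigenbasis // -/B -scalemxAr -scalemxAl mxE.
set M := \matrix_(i, j) _.
by rewrite -!mulmxA U1 mulmx1 mulmxA U1 mul1mx mxE.
Qed.

Lemma f_info_eigenbasis (f : R -> R) (f0 : R) :
  f_info f f0 U lam A
  = \sum_i \sum_j
      ((f0 / 2 * ((lam i - lam j) ^+ 2 / m_f f (lam i) (lam j)))%:C)%C * w i j.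
Proof.
rewrite /f_info /fnorm2 /mf_inv.
set X := 'i%C *: _; set M := \matrix_(i, j) _.
rewrite mulmxA mxtrace_mulC !mulmxA.
have -> : adj U *m adj X *m U = adj (adj U *m X *m U).
  by rewrite !adjM adjK mulmxA.
set Y := adj U *m X *m U.
have YE i j : Y i j = 'i%C * (((lam i - lam j)%:C)%C * B i j).
  exact: adj_commutator_eigenbasis.
rewrite /mxtrace mulr_sumr.
under eq_bigr do rewrite mxE mulr_sumr.
rewrite exchange_big; apply: eq_bigr => i _; apply: eq_bigr => j _.
have YY : (Y i j)^* * Y i j = (((lam i - lam j) ^+ 2)%:C)%C * w i j.
  rewrite -normCKC YE !normrM !exprMn normCi expr1n mul1r; congr (_ * _).
  by rewrite -add_Re2_Im2 /= expr0n addr0.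
rewrite adjE [M _ _]mxE -/Y (mulrA (_^*)) YY.
have cE (a b c : R) : ((a * (b / c))%:C)%C
    = (a%:C)%C * ((b%:C)%C / (c%:C)%C) :> R[i] by rewrite !rmorphM fmorphV.
rewrite cE.
by rewrite -[RHS]mulrA; congr (_ * _); exact: mulrAC.
Qed.

Lemma sld_info_eigenbasis :
  sld_info U lam A
  = \sum_i \sum_j
      (((lam i - lam j) ^+ 2 / (2 * (lam i + lam j)))%:C)%C * w i j.
Proof.
(* The weight that comes directly from the trace of [rho L^2]; the factor [lam i] makes it
   asymmetric in [i] and [j]. *)
pose g i j := (lam i * ((lam i - lam j) ^+ 2 / (lam i + lam j) ^+ 2)).
have -> : sld_info U lam A = \sum_i \sum_j ((g i j)%:C)%C * w i j.
  rewrite /sld_info /sld_L /=.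
  rewrite {1}/spec_mx !conj_mxM // mxtrace_conj // /mxtrace mulr_sumr.
  apply: eq_bigr => i _.
  rewrite /diagR mul_diag_mx mxE mxE mxE mulrA mulr_sumr.
  apply: eq_bigr => j _; rewrite mxE [X in _ * (_ * X)]mxE.
  rewrite !adj_commutator_eigenbasis -eigen_weightE /g.
  rewrite [lam j + lam i]addrC -[lam j - lam i]opprB.
  have lij : lam i + lam j != 0 by rewrite gt_eqF // addr_gt0.
  rewrite !(rmorphM, fmorphV, rmorphN, rmorphXn) /=.
  have ii : 'i%C * 'i%C = -1 :> R[i] by rewrite -expr2 sqr_i.
  have nz : ((lam i + lam j)%:C)%C != 0 :> R[i].
    by rewrite fmorph_eq0.
  set z := ((lam i + lam j)%:C)%C in nz *.
  set l := ((lam i)%:C)%C; set u := ((lam i - lam j)%:C)%C.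
  (* The minus sign comes from the antisymmetry of [lam i - lam j] and cancels against the square of
     ['i]. *)
  transitivity (- ('i%C * 'i%C) * (l * (u ^+ 2 / z ^+ 2) * (B i j * B j i))).
    by field; rewrite -rmorphD.
  by rewrite ii opprK mul1r.
have gT : \sum_i \sum_j ((g i j)%:C)%C * w i j
          = \sum_i \sum_j ((g j i)%:C)%C * w i j.
  rewrite exchange_big; apply: eq_bigr => i _; apply: eq_bigr => j _ /=.
  by rewrite eigen_weight_sym.
(* After doubling, one copy is transposed: [g i j + g j i] is twice the claimed weight. *)
apply: (@mulfI _ 2); first by rewrite pnatr_eq0.
rewrite {1}mulr_natl mulr2n {2}gT -big_split mulr_sumr.
apply: eq_bigr => i _; rewrite -big_split mulr_sumr; apply: eq_bigr => j _ /=.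
have lij : lam i + lam j != 0 by rewrite gt_eqF // addr_gt0.
rewrite -mulrDl [RHS]mulrA; congr (_ * _).
rewrite -[2 in RHS](rmorph_nat (real_complex R)) -rmorphD -rmorphM /=.
by congr (_%:C)%C; rewrite /g; field; rewrite lij.
Qed.

Lemma wy_info_eigenbasis :
  wy_info U lam A
  = \sum_i \sum_j
      (((Num.sqrt (lam i) - Num.sqrt (lam j)) ^+ 2 / 2)%:C)%C * w i j.
Proof.
rewrite /wy_info /= commutator_eigenbasis // conj_mxM // mxtrace_conj //.
rewrite /mxtrace mulr_sumr; apply: eq_bigr => i _.
rewrite mxE mulr_sumr; apply: eq_bigr => j _.
rewrite mxE [X in _ * (_ * X)]mxE -/B.
(* Antisymmetry of the difference of roots absorbs the sign of the prefactor [- 2^-1]. *)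
rewrite -eigen_weightE -[Num.sqrt (lam j) - _]opprB.
rewrite !(rmorphM, fmorphV, rmorphN, rmorphXn, rmorph_nat) /=.
by field.
Qed.

Lemma weighted_sum_le (k k' : 'I_n -> 'I_n -> R) :
  (forall i j, k i j <= k' i j) ->
  \sum_i \sum_j ((k i j)%:C)%C * w i j <= \sum_i \sum_j ((k' i j)%:C)%C * w i j.
Proof.
move=> kk; apply: ler_sum => i _; apply: ler_sum => j _.
by rewrite ler_wpM2r ?eigen_weight_ge0 ?lecR.
Qed.

End Eigenbasis.

(** * Scalar inequalities between the weights *)

Lemma weighted_sumZ (R : rcfType) (n : nat) (a : R) (k : 'I_n -> 'I_n -> R)
    (w : 'I_n -> 'I_n -> R[i]) :
  (a%:C)%C * \sum_i \sum_j ((k i j)%:C)%C * w i j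
  = \sum_i \sum_j ((a * k i j)%:C)%C * w i j.
Proof.
rewrite mulr_sumr; apply: eq_bigr => i _; rewrite mulr_sumr.
by apply: eq_bigr => j _; rewrite mulrA -rmorphM.
Qed.

(** With [p] and [q] the roots, [(x - y)^2 = (p - q)^2 (p + q)^2], and
    [p^2 + q^2 <= (p + q)^2 <= 2 (p^2 + q^2)]. The gaps [2 p q] and [(p - q)^2] give [D0] and
    [D1]. *)
Lemma sqrt_sub_sld_bounds (R : rcfType) (x y : R) : 0 < x -> 0 < y ->
  (Num.sqrt x - Num.sqrt y) ^+ 2 / 2 <= (x - y) ^+ 2 / (2 * (x + y))
  <= 2 * ((Num.sqrt x - Num.sqrt y) ^+ 2 / 2).
Proof.
move=> x0 y0; rewrite -{2 3 4 5}[x](sqr_sqrtr (ltW x0)).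
rewrite -{2 3 4 5}[y](sqr_sqrtr (ltW y0)).
have p0 : 0 < Num.sqrt x by rewrite sqrtr_gt0.
have q0 : 0 < Num.sqrt y by rewrite sqrtr_gt0.
move: (Num.sqrt x) (Num.sqrt y) p0 q0 => p q p0 q0.
have pq0 : 0 < 2 * (p ^+ 2 + q ^+ 2).
  by rewrite mulr_gt0 // addr_gt0 // exprn_gt0.
rewrite ler_pdivlMr // ler_pdivrMr //.
have D0 : 0 <= (p - q) ^+ 2 * (p * q).
  by rewrite mulr_ge0 ?sqr_ge0 // mulr_ge0 // ltW.
have D1 : 0 <= (p - q) ^+ 2 * (p - q) ^+ 2 by rewrite mulr_ge0 ?sqr_ge0.
by apply/andP; split; lra.
Qed.

Lemma m_f_gt0 (R : rcfType) (f : R -> R) (x y : R) :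
  F_op f -> 0 < x -> 0 < y -> 0 < m_f f x y.
Proof. by case=> fp _ _ _ x0 y0; rewrite mulr_gt0 // fp // divr_gt0. Qed.

Lemma m_f_bounds (R : realType) (f : R -> R) (f0 x y : R) :
  F_op f -> (f x @[x --> 0^'+] --> f0)%classic -> 0 < x -> 0 < y ->
  f0 * (x + y) <= m_f f x y <= (x + y) / 2.
Proof.
move=> Ff cf x0 y0; have yx : 0 < y / x by rewrite divr_gt0.
have xy : x + y = x * (1 + y / x) by field; rewrite gt_eqF.
rewrite /m_f xy; apply/andP; split.
  by rewrite mulrCA ler_pM2l // F_op_ge_f0.
by rewrite -mulrA ler_pM2l // F_op_le_mean.
Qed.

(** Up to the common factor [d ^+ 2 / 2] the claim is [f0 / m <= 1 / s <= 1 / (2 m)], a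
    rearrangement of the bounds on [m]. *)
Lemma f_info_weight_bounds (R : realFieldType) (f0 m s d : R) :
  f0 != 0 -> 0 < m -> 0 < s -> f0 * s <= m <= s / 2 ->
  f0 / 2 * (d ^+ 2 / m) <= d ^+ 2 / (2 * s)
  <= (2 * f0)^-1 * (f0 / 2 * (d ^+ 2 / m)).
Proof.
move=> f0n m0 s0 /andP[lo hi].
have sn : s != 0 by rewrite gt_eqF.
have mn : m != 0 by rewrite gt_eqF.
have D0 : 0 <= d ^+ 2 / 2 by rewrite divr_ge0 ?sqr_ge0.
have -> : f0 / 2 * (d ^+ 2 / m) = d ^+ 2 / 2 * (f0 / m) by field.
have -> : d ^+ 2 / (2 * s) = d ^+ 2 / 2 * s^-1 by field.
have -> : (2 * f0)^-1 * (d ^+ 2 / 2 * (f0 / m)) = d ^+ 2 / 2 * (m * 2)^-1.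
  by field; rewrite mn f0n.
rewrite !ler_wpM2l //.
  by rewrite lef_pV2 ?posrE // ?mulr_gt0 // -ler_pdivlMr.
by rewrite ler_pdivrMr // mulrC ler_pdivlMr.
Qed.

(** * Termwise comparison of the informations *)

Unset Implicit Arguments.

Theorem mainTheorem5 (R : realType) (f : R -> R) (f0 : R) :
  F_op f ->
  (f x @[x --> 0^'+] --> f0)%classic ->
  f0 != 0 ->
  forall (n : nat) (rho A : 'M[R[i]]_n),
    faithful_density rho -> hermitian_mx A ->
    forall (U : 'M[R[i]]_n) (lam : 'I_n -> R),
      unitary U -> rho = spec_mx U lam ->
      (f_info f f0 U lam A <= sld_info U lam A
         <= (((2 * f0)^-1)%:C)%C * f_info f f0 U lam A)
      /\ (wy_info U lam A <= sld_info U lam A <= 2 * wy_info U lam A).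
Proof.
move=> Ff cf f0n n rho A [_ rho0 _] hA U lam Uu rhoE.
have lam0 : forall k, 0 < lam k.
  by apply: spec_mx_eigenvalue_gt0 Uu _; rewrite -rhoE.
(* Viewed as a real scalar, the factor [2] can be moved into the weights. *)
have two : 2 = ((2 : R)%:C)%C :> R[i] by rewrite rmorph_nat.
rewrite two f_info_eigenbasis // sld_info_eigenbasis // wy_info_eigenbasis //.
rewrite !weighted_sumZ.
have f_bounds i j : _ := f_info_weight_bounds (lam i - lam j) f0n
  (m_f_gt0 Ff (lam0 i) (lam0 j)) (addr_gt0 (lam0 i) (lam0 j))
  (m_f_bounds Ff cf (lam0 i) (lam0 j)).
have wy_bounds i j := sqrt_sub_sld_bounds (lam0 i) (lam0 j).
by split; apply/andP; split; apply: weighted_sum_le => i j;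
  have /andP[] := f_bounds i j; have /andP[] := wy_bounds i j.
Qed.
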